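(* Let $n\ge 1$ and let $\Sigma_1,\ldots,\Sigma_n$ be $L^2$-well-posed systems with scalar inputs and outputs, each output strictly passive (OSP), with secant gains $\gamma_1,\ldots,\gamma_n$ respectively. Consider their cascade under unity negative feedback, with external input $u$: the input of $\Sigma_1$ is $u-y_n$ and, for $i=2,\ldots,n$, the input of $\Sigma_i$ is $y_{i-1}$, where $y_i$ denotes the output of $\Sigma_i$. Assume that this closed-loop system is $L^2$-well-posed. Suppose that $$\gamma_1\gamma_2\cdots\gamma_n \;<\; \left(\sec\frac{\pi}{n}\right)^n ,$$ where for $n=1$ and $n=2$ this condition is interpreted as being satisfied for all values of the $\gamma_i$'s. Then the closed-loop system is $L^2$-stable: there is a number $c$ such that $$\|y_n\|_T\;\le\; c\,\|u\|_T$$ for all input/output pairs $(u,y_n)$ of the closed-loop system (external input $u\in L^2_e(0,\infty)$, zero initial state) and all $T>0$.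
   Context: Signals: $L^2_e(0,\infty)$ is the set of functions $w:[0,\infty)\to\mathbb{R}$ whose restriction $w_T=w|_{[0,T]}$ lies in $L^2(0,T)$ for every $T>0$. For $v,w\in L^2_e(0,\infty)$ and $T>0$, $\|w\|_T$ is the $L^2(0,T)$ norm of $w_T$, and $\langle v,w\rangle_T$ is the $L^2(0,T)$ inner product of $v_T$ and $w_T$. Systems: a system is a continuous-time finite-dimensional system $\dot x=f(x,u)$, $y=h(x)$ in the usual sense of control theory, with scalar input $u$, scalar output $y$, and state space some $\mathbb{R}^m$. It is $L^2$-well-posed if for each $u\in L^2_e(0,\infty)$ and initial state $x(0)=0$ there is a unique solution $x(\cdot)$ defined for all $t\ge 0$, and the corresponding output $y(t)=h(x(t))$ is in $L^2_e(0,\infty)$; then $(u,y)$ is called an input/output (i/o) pair of the system. Thus i/o pairs always refer to zero initial state. $L^2$-well-posedness of the closed-loop system means the same with external input $u$ and composite state $(x_1,\ldots,x_n)$ starting at zero: a unique solution exists for all $t\ge0$ and the outputs $y_1,\ldots,y_n$ all lie in $L^2_e(0,\infty)$. OSP and secant gain: a system is output strictly passive (OSP) if there is some $\gamma>0$ such that, for every i/o pair $(u,y)$ and all $T>0$, $$\|y\|_T^2\;\le\;\gamma\,\langle u,y\rangle_T .$$ The secant gain of an OSP system is the smallest $\gamma$ with this property (understood as the infimum of all such $\gamma$, which itself satisfies the inequality). *)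

(* Defs.v *)
From HB Require Import structures.
From mathcomp Require Import all_boot all_order all_algebra.
From mathcomp Require Import all_classical all_reals all_analysis.

Set Implicit Arguments.
Unset Strict Implicit.
Unset Printing Implicit Defensive.

Import Order.TTheory GRing.Theory Num.Theory.
Import numFieldNormedType.Exports.

Local Open Scope classical_set_scope.
Local Open Scope ring_scope.

(* Signals are functions R -> R; only their values on [0, +oo[ ever matter.
   The restriction to [0, T] is extended by zero. *)

Definition truncate (R : realType) (T : R) (w : R -> R) : R -> R :=
  w \_ `[0, T].

Definition L2e (R : realType) (w : R -> R) : Prop :=
  forall T : R, 0 < T -> truncate T w \in Lfun (@lebesgue_measure R) 2%:E.

Definition norm_upto (R : realType) (T : R) (w : R -> R) : R :=
  fine (Lnorm (@lebesgue_measure R) 2%:E (EFin \o truncate T w)).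

Definition inner_upto (R : realType) (T : R) (v w : R -> R) : R :=
  Rintegral (@lebesgue_measure R) `[0, T] (fun t => v t * w t).

(* x' = f(x, u), y = h(x). No regularity of [dynamics] and [readout] is built
   in: well-posedness is an explicit hypothesis wherever it is needed. *)
Record system (R : realType) := System {
  state_dim : nat;
  dynamics : 'rV[R]_state_dim -> R -> 'rV[R]_state_dim;
  readout : 'rV[R]_state_dim -> R }.

(* Caratheodory solutions on [0, +oo[ with x(0) = 0: the integral equation
     x(t) = \int_0^t f(x(s), u(s)) ds,
   which amounts to x being locally absolutely continuous with x(0) = 0 and
   x' = f(x, u) almost everywhere. *)
Definition solution (R : realType) (S : system R) (u : R -> R)
    (x : R -> 'rV[R]_(state_dim S)) : Prop :=
  forall (t : R) (j : 'I_(state_dim S)), 0 <= t ->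
    (@lebesgue_measure R).-integrable `[0, t]
      (fun s => (dynamics (x s) (u s) 0 j)%:E) /\
    x t 0 j = Rintegral (@lebesgue_measure R) `[0, t]
      (fun s => dynamics (x s) (u s) 0 j).

Definition output (R : realType) (S : system R)
    (x : R -> 'rV[R]_(state_dim S)) : R -> R :=
  fun t => readout (x t).

Definition well_posed (R : realType) (S : system R) : Prop :=
  forall u : R -> R, L2e u ->
    exists x : R -> 'rV[R]_(state_dim S),
      [/\ solution u x,
          (forall x', solution u x' -> forall t, 0 <= t -> x' t = x t) &
          L2e (output x)].

Definition io_pair (R : realType) (S : system R) (u y : R -> R) : Prop :=
  L2e u /\
  exists2 x : R -> 'rV[R]_(state_dim S),
    solution u x & forall t, 0 <= t -> y t = output x t.

Definition osp_bound (R : realType) (S : system R) (gamma : R) : Prop :=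
  forall u y : R -> R, io_pair S u y ->
    forall T : R, 0 < T -> norm_upto T y ^+ 2 <= gamma * inner_upto T u y.

Definition output_strictly_passive (R : realType) (S : system R) : Prop :=
  exists2 gamma : R, 0 < gamma & osp_bound S gamma.

(* May be 0, namely when every output vanishes almost everywhere. *)
Definition secant_gain (R : realType) (S : system R) : R :=
  inf [set gamma : R | 0 < gamma /\ osp_bound S gamma].

(* The input of subsystem i in the loop. [ord_pred] is the cyclic predecessor
   on 'I_n, so that ord_pred 0 = n - 1 is the last subsystem. *)
Definition loop_input (R : realType) (n : nat) (Sigma : 'I_n -> system R)
    (u : R -> R) (x : forall i, R -> 'rV[R]_(state_dim (Sigma i)))
    (i : 'I_n) : R -> R :=
  if i == 0 :> nat then fun t => u t - output (x (ord_pred i)) t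
  else output (x (ord_pred i)).

Definition loop_solution (R : realType) (n : nat) (Sigma : 'I_n -> system R)
    (u : R -> R) (x : forall i, R -> 'rV[R]_(state_dim (Sigma i))) : Prop :=
  forall i, solution (loop_input u x i) (x i).

Definition loop_well_posed (R : realType) (n : nat)
    (Sigma : 'I_n -> system R) : Prop :=
  forall u : R -> R, L2e u ->
    exists x : forall i, R -> 'rV[R]_(state_dim (Sigma i)),
      [/\ loop_solution u x,
          (forall x', loop_solution u x' ->
             forall i t, 0 <= t -> x' i t = x i t) &
          forall i, L2e (output (x i))].

Lemma ltn_pred_gt0 (n : nat) : (0 < n)%N -> (n.-1 < n)%N.
Proof. by rewrite ltn_predL. Qed.

Definition last_index (n : nat) (n_gt0 : (0 < n)%N) : 'I_n :=
  Ordinal (ltn_pred_gt0 n_gt0).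

(* The pairs (u, y_n). *)
Definition loop_io_pair (R : realType) (n : nat) (n_gt0 : (0 < n)%N)
    (Sigma : 'I_n -> system R) (u y : R -> R) : Prop :=
  L2e u /\
  exists2 x : forall i, R -> 'rV[R]_(state_dim (Sigma i)),
    loop_solution u x &
    forall t, 0 <= t -> y t = output (x (last_index n_gt0)) t.

Definition sec (R : realType) (a : R) : R := (cos a)^-1.

(* Main.v *)
Require Import Defs.
From mathcomp Require Import all_boot all_order all_algebra.
From mathcomp Require Import all_classical all_reals all_analysis.
From mathcomp Require Import ring lra.

Import Order.TTheory GRing.Theory Num.Theory.
Import numFieldNormedType.Exports.

Local Open Scope ring_scope.

(* The cyclic form \sum_k z_(k-1) z_k with z_0 = - z_n is at most
   cos (pi / n) \sum_k z_k^2.  Rescaling the outputs so that every subsystem has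
   the same gain g, with g^n = gamma_1 ... gamma_n, the secant condition
   g cos (pi / n) < 1 therefore makes a weighted sum of the passivity inequalities
   strictly dissipative.  The estimate is pointwise in time, hence is integrated
   over [0, T].  The gains used are true passivity constants slightly above the
   secant gains, which also covers vanishing secant gains. *)

(** * Quadratic forms along a chain and around the loop *)

(* The left-hand side divided by [sin (m.+1 * th)] is the minimum of the chain
   energy on the right over the interior values of [z], the ends being fixed. *)
Lemma chain_form_ge (R : realType) (th : R) (z : nat -> R) (m : nat) :
  0 < th -> m.+1%:R * th < pi ->
  sin th * (cos (m.+1%:R * th) * ((z 0%N ^+ 2 + z m.+1 ^+ 2) / 2)
            - z 0%N * z m.+1)
  <= sin (m.+1%:R * th) *
     \sum_(k < m.+1) (cos th * ((z k ^+ 2 + z k.+1 ^+ 2) / 2) - z k * z k.+1).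
Proof.
move=> th0; elim: m => [|m IHm] lt_pi.
  by rewrite big_ord_recl big_ord0 mul1r addr0.
have lt_pi' : m.+1%:R * th < pi.
  by apply: le_lt_trans lt_pi; rewrite ler_pM2r// ler_nat.
move: (IHm lt_pi'); rewrite [in X in _ -> X]big_ord_recr /=.
set X := \sum_(i < _) _.
have S0 : 0 < sin (m.+1%:R * th) by rewrite sin_gt0_pi// mulr_gt0//= ltr0n.
have D0 : 0 < sin (m.+2%:R * th) by rewrite sin_gt0_pi// mulr_gt0//= ltr0n.
move: D0.
have -> : m.+2%:R * th = m.+1%:R * th + th by rewrite -natr1 mulrDl mul1r.
rewrite sinD cosD.
have := cos2Dsin2 (m.+1%:R * th); have := cos2Dsin2 th.
move: S0; move: (sin (m.+1%:R * th)) (cos (m.+1%:R * th)) (sin th) (cos th).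
move: X (z 0%N) (z m.+1) (z m.+2) => X a b d S C s c S0 h1 h2 D0 IH.
rewrite -(ler_pM2l S0) -subr_ge0.
have {}IH := ler_wpM2l (ltW D0) IH.
(* Here [S * c + C * s] is sin (m.+2 * th). The first square vanishes exactly when [b] takes its
   minimising value (a s + d S) / (S c + C s); the last two terms vanish because cos^2 + sin^2 =
   1. *)
rewrite [X in 0 <= X](_ : _ =
  ((S * c + C * s) * (S * X)
     - (S * c + C * s) * (s * (C * ((a ^+ 2 + b ^+ 2) / 2) - a * b)))
    + ((S * c + C * s) * b - (a * s + d * S)) ^+ 2 / 2
    + (S * d) ^+ 2 / 2 * (c ^+ 2 + s ^+ 2 - 1)
    + (s * a) ^+ 2 / 2 * (C ^+ 2 + S ^+ 2 - 1)); last by field.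
by rewrite h1 h2 !subrr !mulr0 !addr0 addr_ge0// ?subr_ge0// divr_ge0 ?sqr_ge0.
Qed.

(** With n = m.+1 >= 2 and th = pi / n, apply the chain estimate to the first n - 1 links. Then sin
    ((n-1) th) = sin th cancels, cos ((n-1) th) = - cos th, and z_0 = - z_n turns the product of the
    chain ends into minus the missing last link. For n = 1 both sides are equal. *)
Lemma cyclic_form_le (R : realType) (m : nat) (z : nat -> R) :
  z 0%N = - z m.+1 ->
  \sum_(k < m.+1) z k * z k.+1
  <= cos (pi / m.+1%:R) * \sum_(k < m.+1) z k.+1 ^+ 2.
Proof.
move=> z0.
case: m z0 => [|m] z0.
  by rewrite !big_ord_recl !big_ord0 !addr0 divr1 cospi z0 mulN1r mulNr expr2.
set th : R := pi / m.+2%:R.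
have n0 : (0 : R) < m.+2%:R by rewrite ltr0n.
have th0 : 0 < th by rewrite divr_gt0// pi_gt0.
have thE : m.+1%:R * th = - th + pi.
  by rewrite -[pi in RHS](divfK (lt0r_neq0 n0)) -/th -[in RHS]natr1; ring.
have lt_pi : m.+1%:R * th < pi by rewrite thE; lra.
have s0 : 0 < sin th.
  rewrite sin_gt0_pi// th0/=; apply: le_lt_trans lt_pi.
  by rewrite ler_peMl ?ler1n ?ltW.
have := chain_form_ge _ _ z _ th0 lt_pi.
rewrite thE sinDpi cosDpi sinN cosN opprK ler_pM2l// sumrB -mulr_sumr.
rewrite -mulr_suml big_split/= [\sum_(k < m.+1) z k ^+ 2]big_ord_recl/=.
rewrite [\sum_(k < m.+1) z k.+1 ^+ 2]big_ord_recr/=.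
rewrite [\sum_(k < m.+2) z k * _]big_ord_recr [\sum_(k < m.+2) _]big_ord_recr/=.
rewrite [\sum_(k < m.+1) z k.+1 ^+ 2]big_ord_recr/= z0.
rewrite /bump/=; under eq_bigr do rewrite add1n.
set A := \sum_(i < m) _; lra.
Qed.

(* Writing [y k = s k.+1 * z k.+1] with [s k := (\prod_(j < k) gam j) / g ^+ k]
   gives every link of the loop the same gain [g]; the weights are [s k.+1 ^- 2]. *)
Lemma loop_form_le (R : realType) (m : nat) (gam : nat -> R) (g : R) :
  (forall k, 0 < gam k) -> 0 < g -> g ^+ m.+1 = \prod_(k < m.+1) gam k ->
  g * cos (pi / m.+1%:R) < 1 ->
  exists d : nat -> R, exists eta K : R,
    [/\ forall k, 0 < d k, eta < 1, 0 <= K &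
    forall (u : R) (y : nat -> R),
      \sum_(k < m.+1)
        d k * (gam k * ((if k : nat is k'.+1 then y k' else u - y m) * y k))
      <= eta * (\sum_(k < m.+1) d k * y k ^+ 2) + K * u ^+ 2].
Proof.
move=> gam0 g0 gE gc1; set c := cos _ in gc1 *.
pose s k := (\prod_(j < k) gam j) / g ^+ k.
have s_gt0 k : 0 < s k by rewrite divr_gt0 ?prodr_gt0 ?exprn_gt0.
have s0 : s 0%N = 1 by rewrite /s big_ord0 divr1.
(* The choice of [g] makes the scaling return to 1 after one turn, so the rescaled loop still closes
   with a mere sign change. *)
have sn : s m.+1 = 1 by rewrite /s -gE divff// expf_neq0// gt_eqF.
have sS k : s k.+1 = s k * gam k / g.
  rewrite /s big_ord_recr/= exprS; field.
  by rewrite expf_neq0 ?gt_eqF.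
pose del := 1 - g * c; have del0 : 0 < del by rewrite subr_gt0.
(* Half of the margin [del] absorbs the cross term g u z_1 by Young's inequality, at the price [K];
   the other half keeps [eta] = 1 - del / 2 below 1. *)
exists (fun k => (s k.+1) ^- 2), (g * c + del / 2), (g ^+ 2 / (2 * del)).
split=> [k|||u y].
- by rewrite invr_gt0 exprn_gt0.
- by rewrite /del; lra.
- by rewrite divr_ge0 ?sqr_ge0// mulr_ge0// ltW.
pose z k := if k is k'.+1 then y k' / s k else - y m.
have zz k : s k.+1 ^- 2 * y k ^+ 2 = z k.+1 ^+ 2.
  by rewrite /z; field; rewrite gt_eqF.
under [in X in _ <= X]eq_bigr do rewrite zz.
have z0 : z 0%N = - z m.+1 by rewrite /z sn divr1.
rewrite (_ : \sum_(k < m.+1) _ =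
  g * (\sum_(k < m.+1) z k * z k.+1) + g * (u * z 1%N)).
  have := cyclic_form_le _ _ _ z0; rewrite -/c => /(ler_wpM2l (ltW g0)).
  rewrite [X in _ * (c * X)]big_ord_recl [X in (_ + _) * X]big_ord_recl /=.
  set A := \sum_(i < m) _; set B := \sum_(i < _) _.
  have A0 : 0 <= A by apply: sumr_ge0 => i _; rewrite sqr_ge0.
  move=> hB.
  have young : g * (u * (y 0%N / s 1%N)) <=
      del / 2 * (y 0%N / s 1%N) ^+ 2 + g ^+ 2 / (2 * del) * u ^+ 2.
    rewrite -subr_ge0 [X in 0 <= X](_ : _ =
      (del * (y 0%N / s 1%N) - g * u) ^+ 2 / (2 * del)).
      by rewrite divr_ge0 ?sqr_ge0// mulr_ge0// ltW.
    by field; rewrite !gt_eqF.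
  (* Young's inequality uses the square of z_1 only; this fills in the other squares. *)
  have : 0 <= del / 2 * A by rewrite mulr_ge0// divr_ge0// ltW.
  move: hB young; lra.
rewrite !big_ord_recl/= mulrDr addrAC; congr (_ + _).
  by rewrite sS s0; field; rewrite !gt_eqF.
rewrite mulr_sumr; apply: eq_bigr => i _.
rewrite /bump/= !add1n/= [s i.+2]sS; field.
by rewrite !gt_eqF.
Qed.

(** * Passivity constants close to the secant gains *)

(** The perturbed product is a polynomial in [e], hence continuous at 0. *)
Lemma prodr_perturb_lt (R : realType) (I : finType) (a : I -> R) (C : R) :
  \prod_i a i < C -> exists2 e, 0 < e & \prod_i (a i + e) < C.
Proof.
pose p : {poly R} := \prod_i ((a i)%:P + 'X).
have pE e : p.[e] = \prod_i (a i + e).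
  by rewrite horner_prod; apply: eq_bigr => i _; rewrite !hornerE.
have -> : \prod_i a i = p.[0] by rewrite pE; apply: eq_bigr => i _; rewrite addr0.
move=> /lt_nbhsl/continuous_horner/nbhs_ballP[r /= r0 rC].
exists (r / 2); first by rewrite divr_gt0.
by rewrite -pE; apply: rC; rewrite /ball/= sub0r normrN gtr0_norm ?divr_gt0//; lra.
Qed.

(** Each infimum is approached within a common [e], chosen so small that the product stays below
    [C]. *)
Lemma exists_osp_bounds (R : realType) (I : finType) (Sigma : I -> system R)
    (C : R) :
  (forall i, output_strictly_passive (Sigma i)) ->
  \prod_i secant_gain (Sigma i) < C ->
  exists gam : I -> R,
    (forall i, 0 < gam i /\ osp_bound (Sigma i) (gam i)) /\ \prod_i gam i < C.
Proof.
move=> osp /prodr_perturb_lt[e e0 eC].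
have /choice[gam gamP] (i : I) : exists g : R,
    (0 < g /\ osp_bound (Sigma i) g) /\ g < secant_gain (Sigma i) + e.
  have [g0 g00 g0b] := osp i.
  have [|g gP ge] := @inf_adherent R
    [set g | 0 < g /\ osp_bound (Sigma i) g]%classic e e0; last by exists g.
  by split; [exists g0|exists 0 => x [/ltW]].
exists gam; split=> [i|]; first by have [] := gamP i.
apply: le_lt_trans eC; apply: ler_prod => i _.
by have [[g0 _] gle] := gamP i; rewrite !ltW.
Qed.

(** * Truncated signals, norms and integrals *)

Lemma truncateM (R : realType) (T : R) (v w : R -> R) :
  (truncate T v \* truncate T w)%R = truncate T (v \* w).
Proof.
apply/funext => t; rewrite /truncate /= !patchE; case: ifP => // _.
by rewrite mul0r.
Qed.

(** Hölder's inequality, applied to the truncations. *)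
Lemma L2e_integrableM (R : realType) (T : R) (v w : R -> R) :
  0 < T -> L2e v -> L2e w ->
  (@lebesgue_measure R).-integrable `[0, T]%classic
    (EFin \o (fun t => v t * w t)).
Proof.
move=> T0 /(_ T T0) hv /(_ T T0) hw.
have /Lfun1_integrable := Lfun2_mul_Lfun1 hv hw.
rewrite truncateM => h; apply/integrable_mkcond => //.
by rewrite restrict_EFin.
Qed.

Lemma norm_upto_sqr (R : realType) (T : R) (w : R -> R) :
  norm_upto T w ^+ 2 = inner_upto T w w.
Proof.
rewrite /norm_upto /inner_upto unlock Rintegral_mkcond /Rintegral fine_poweR.
rewrite -powR_mulrn ?powR_ge0// -powRrM mulVf// powRr1; last first.
  by rewrite fine_ge0// integral_ge0// => t _; exact: poweR_ge0.
congr fine; apply: eq_integral => t _ /=.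
rewrite powR_mulrn// real_normK ?num_real// /truncate !patchE.
by case: ifP; rewrite ?expr2 ?mulr0.
Qed.

Lemma norm_upto_ge0 (R : realType) (T : R) (w : R -> R) : 0 <= norm_upto T w.
Proof. by rewrite fine_ge0// Lnorm_ge0. Qed.

Lemma eq_truncate (R : realType) (T : R) (v w : R -> R) :
  (forall t, 0 <= t -> v t = w t) -> truncate T v = truncate T w.
Proof.
move=> vw; apply/funext => t; rewrite /truncate !patchE; case: ifP => //.
by rewrite inE/= in_itv/= => /andP[/vw].
Qed.

Lemma eq_L2e (R : realType) (v w : R -> R) :
  (forall t, 0 <= t -> v t = w t) -> L2e v -> L2e w.
Proof. by move=> vw hv T T0; rewrite -(eq_truncate _ T _ _ vw); exact: hv. Qed.

Lemma L2eB (R : realType) (v w : R -> R) : L2e v -> L2e w -> L2e (fun t => v t - w t).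
Proof.
move=> hv hw T T0.
have -> : truncate T (fun t => v t - w t) = truncate T v - truncate T w.
  apply/funext => t; rewrite /truncate/= !fctE !patchE; case: ifP => // _.
  by rewrite subr0.
have h12 : (1%:E <= 2%:E :> \bar R)%E by rewrite lee_fin ler1n.
have [_ /(_ (-1) _ _ (hw T T0) (hv T T0))] :=
  Lfun_submod_closed (@lebesgue_measure R) h12.
by rewrite scaleN1r addrC.
Qed.

Lemma Rintegral_sum d (T : measurableType d) (R : realType)
    (mu : {measure set T -> \bar R}) (D : set T) (I : Type) (s : seq I)
    (f : I -> T -> R) :
  measurable D -> (forall i, mu.-integrable D (EFin \o f i)) ->
  Rintegral mu D (fun x => \sum_(i <- s) f i x) = \sum_(i <- s) Rintegral mu D (f i).
Proof.
move=> mD fi; rewrite /Rintegral.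
under eq_integral do rewrite -sumEFin.
rewrite integral_sum// -sum_fine// => i _.
by have := integrable_fin_num mD (fi i).
Qed.

(** * Signals and gains of the closed loop *)

(** Well-posedness provides one solution with such outputs, and uniqueness identifies every other
    solution with it on [0, +oo[. *)
Lemma loop_solution_L2e (R : realType) (n : nat) (Sigma : 'I_n -> system R)
    (u : R -> R) (x : forall i, R -> 'rV[R]_(state_dim (Sigma i))) :
  loop_well_posed Sigma -> L2e u -> loop_solution u x ->
  forall i, L2e (output (x i)).
Proof.
move=> wp u2 /[dup] xs; have [x' [_ uniq y2]] := wp u u2.
move=> /uniq xx' i; apply: eq_L2e (y2 i) => t t0.
by rewrite /output xx'.
Qed.

(** Makes the signals of each subsystem in the loop an i/o pair, to which its passivity inequality
    applies. *)
Lemma loop_input_L2e (R : realType) (n : nat) (Sigma : 'I_n -> system R)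
    (u : R -> R) (x : forall i, R -> 'rV[R]_(state_dim (Sigma i))) :
  L2e u -> (forall i, L2e (output (x i))) -> forall i, L2e (loop_input u x i).
Proof.
by move=> u2 y2 i; rewrite /loop_input; case: ifP => // _; exact: L2eB.
Qed.

(* Below three subsystems the cosine is nonpositive, so any gains will do. *)
Lemma exists_loop_gains (R : realType) (m : nat) (Sigma : 'I_m.+1 -> system R) :
  (forall i, output_strictly_passive (Sigma i)) ->
  ((3 <= m.+1)%N ->
     \prod_i secant_gain (Sigma i) < sec (pi / m.+1%:R) ^+ m.+1) ->
  exists gam : 'I_m.+1 -> R, exists g : R,
    [/\ forall i, 0 < gam i, forall i, osp_bound (Sigma i) (gam i),
     0 < g, g ^+ m.+1 = \prod_i gam i & g * cos (pi / m.+1%:R) < 1].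
Proof.
move=> osp secant.
suff [gam [gamP gc]] : exists gam : 'I_m.+1 -> R,
    (forall i, 0 < gam i /\ osp_bound (Sigma i) (gam i)) /\
    forall g, 0 < g -> g ^+ m.+1 = \prod_i gam i -> g * cos (pi / m.+1%:R) < 1.
  have P0 : 0 < \prod_i gam i by apply: prodr_gt0 => i _; have [] := gamP i.
  pose g := (\prod_i gam i) `^ m.+1%:R^-1.
  have g0 : 0 < g by rewrite powR_gt0.
  have gE : g ^+ m.+1 = \prod_i gam i.
    by rewrite -powR_mulrn ?ltW// -powRrM mulVf// powRr1// ltW.
  by exists gam, g; split=> // [i|i|]; [have [] := gamP i|have [] := gamP i|exact: gc].
have [n3|n3] := leqP 3 m.+1.
  have [gam [gamP gam_lt]] := exists_osp_bounds _ _ _ _ osp (secant n3).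
  exists gam; split=> // g g0 gE.
  have c0 : 0 < cos (pi / m.+1%:R) :> R.
    have pi0 := pi_gt0 R.
    rewrite cos_gt0_pihalf// ltr_pM2l// (lt_trans (y := 0)) ?oppr_lt0 ?divr_gt0//=.
    by rewrite ltf_pV2 ?posrE ?ltr0n// ltr_nat.
  (* The cosine being positive, the claim reads g < sec (pi / n), which is compared through n-th
     powers. *)
  rewrite -ltr_pdivlMr// div1r -/(sec _).
  by rewrite -(@ltr_pXn2r _ m.+1) ?nnegrE ?invr_ge0 ?ltW// gE.
have /choice[gam gamP] (i : 'I_m.+1) : exists g, 0 < g /\ osp_bound (Sigma i) g.
  by have [g g0 gb] := osp i; exists g.
exists gam; split=> // g g0 _.
have c0 : cos (pi / m.+1%:R) <= 0 :> R.
  case: m n3 {secant osp gam gamP Sigma} => [|[|//]] _.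
    by rewrite divr1 cospi lerN10.
  by rewrite cos_pihalf.
by rewrite (le_lt_trans _ ltr01)// mulr_ge0_le0// ltW.
Qed.

(** * Energy estimate over a finite horizon *)

Lemma integrable_sumR d (T : measurableType d) (R : realType)
    (mu : {measure set T -> \bar R}) (D : set T) (I : Type) (s : seq I)
    (f : I -> T -> R) :
  measurable D -> (forall i, mu.-integrable D (EFin \o f i)) ->
  mu.-integrable D (EFin \o (fun x => \sum_(i <- s) f i x)).
Proof.
move=> mD fi; have -> : EFin \o (fun x => \sum_(i <- s) f i x) =
    (fun x => \sum_(i <- s) (f i x)%:E) by apply/funext => x /=; rewrite sumEFin.
by apply: integrable_sum => // i _; exact: fi.
Qed.

(** Replaces the cyclic predecessor by the case distinction on which the pointwise estimate
    [loop_form_le] is phrased. *)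
Lemma loop_inputE (R : realType) (m : nat) (Sigma : 'I_m.+1 -> system R)
    (u : R -> R) (x : forall i, R -> 'rV[R]_(state_dim (Sigma i)))
    (i : 'I_m.+1) (t : R) :
  loop_input u x i t =
  if i : nat is k.+1 then output (x (inord k)) t
  else u t - output (x (inord m)) t.
Proof.
have predE k : ((i + m.+1).-1 = k %[mod m.+1])%N -> (k < m.+1)%N ->
    ord_pred i = inord k.
  by move=> ik km; apply/val_inj; rewrite /= ik modn_small// inordK.
rewrite /loop_input; case: i predE => -[|k] kP predE /=.
  by rewrite (predE m).
by rewrite (predE k) // ?modnDr // ltnW.
Qed.

(** The weighted passivity inequalities bound the energy by the integral of the weighted supply
    terms u_i y_i; the quadratic estimate at each time [t] then bounds the integrand. *)
Lemma loop_energy_le (R : realType) (m : nat) (Sigma : 'I_m.+1 -> system R)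
    (gam : 'I_m.+1 -> R) (d : nat -> R) (eta K : R)
    (u : R -> R) (x : forall i, R -> 'rV[R]_(state_dim (Sigma i))) (T : R) :
  (forall i, osp_bound (Sigma i) (gam i)) -> (forall k, 0 < d k) ->
  (forall (v : R) (y : nat -> R),
      \sum_(k < m.+1) d k * (gam (inord k) *
         ((if k : nat is k'.+1 then y k' else v - y m) * y k))
      <= eta * (\sum_(k < m.+1) d k * y k ^+ 2) + K * v ^+ 2) ->
  L2e u -> loop_solution u x -> (forall i, L2e (output (x i))) -> 0 < T ->
  \sum_(i < m.+1) d i * norm_upto T (output (x i)) ^+ 2
  <= eta * (\sum_(i < m.+1) d i * norm_upto T (output (x i)) ^+ 2)
     + K * norm_upto T u ^+ 2.
Proof.
move=> b d0 form u2 xs y2 T0; set E := (\sum_(i < _) _).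
have v2 := loop_input_L2e _ _ _ _ _ u2 y2.
pose leb : {measure set (measurableTypeR R) -> \bar R} := @lebesgue_measure R.
pose D := `[0, T]%classic : set R.
have mD : measurable (D : set (measurableTypeR R)) by exact: measurable_itv.
have iM a v w : L2e v -> L2e w ->
    leb.-integrable D (EFin \o (fun t => a * (v t * w t))).
  move=> hv hw; have := L2e_integrableM _ _ _ _ T0 hv hw.
  exact: integrableZl.
pose f (i : 'I_m.+1) t := d i * gam i * (loop_input u x i t * output (x i) t).
pose h (i : 'I_m.+1) t := d i * (output (x i) t * output (x i) t).
have fi i : leb.-integrable D (EFin \o f i) by exact: iM.
have hi i : leb.-integrable D (EFin \o h i) by exact: iM.
have sh : leb.-integrable D (EFin \o (fun t => \sum_i h i t)).
  exact: integrable_sumR.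
have eh : leb.-integrable D (EFin \o (fun t => eta * \sum_i h i t)).
  by have := integrableZl mD eta sh.
have EE : E = Rintegral leb D (fun t => \sum_i h i t).
  rewrite Rintegral_sum//; apply: eq_bigr => i _.
  by rewrite norm_upto_sqr RintegralZl//; exact: L2e_integrableM.
have Ef : E <= Rintegral leb D (fun t => \sum_i f i t).
  rewrite Rintegral_sum//; apply: ler_sum => i _.
  rewrite RintegralZl//; last exact: L2e_integrableM.
  rewrite -mulrA ler_pM2l//; apply: b => //.
  by split=> //; exists (x i).
apply: le_trans Ef _.
rewrite norm_upto_sqr {1}EE /inner_upto -!RintegralZl// ?L2e_integrableM//.
rewrite -RintegralD//; last exact: iM.
apply: le_Rintegral => //.
- exact: integrable_sumR.
- by have := integrableD mD eh (iM K u u u2 u2).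
move=> t _; have := form (u t) (fun k => output (x (inord k)) t).
rewrite expr2; congr (_ <= _ + _).
  by apply: eq_bigr => i _; rewrite /f loop_inputE inord_val mulrA.
by congr (_ * _); apply: eq_bigr => i _; rewrite inord_val expr2.
Qed.

(** * Stability of the closed loop *)

Theorem mainTheorem1 (R : realType) (n : nat) (n_gt0 : (0 < n)%N)
    (Sigma : 'I_n -> system R)
    (wp : forall i, well_posed (Sigma i))
    (osp : forall i, output_strictly_passive (Sigma i))
    (loop_wp : loop_well_posed Sigma)
    (secant : (3 <= n)%N ->
       \prod_(i < n) secant_gain (Sigma i) < sec (pi / n%:R) ^+ n) :
  exists c : R, forall u y : R -> R, loop_io_pair n_gt0 Sigma u y ->
    forall T : R, 0 < T -> norm_upto T y <= c * norm_upto T u.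
Proof.
case: n n_gt0 Sigma wp osp loop_wp secant => // m n_gt0 Sigma _ osp loop_wp secant.
have [gam [g [gam0 b g0 gE gc]]] := exists_loop_gains _ _ _ osp secant.
have gE' : g ^+ m.+1 = \prod_(k < m.+1) gam (inord k).
  by rewrite gE; apply: eq_bigr => i _; rewrite inord_val.
have [d [eta [K [d0 eta1 K0 form]]]] :=
  loop_form_le _ _ (fun k => gam (inord k)) _ (fun k => gam0 _) g0 gE' gc.
have p0 : 0 < (1 - eta) * d m by rewrite mulr_gt0 ?subr_gt0.
(* Absorbing the [eta] term on the left and dropping the outputs other than y_n leaves (1 - eta) d_m
   |y_n|_T^2 <= K |u|_T^2. *)
exists (Num.sqrt (K / ((1 - eta) * d m))) => u y [u2 [x xs yx]] T T0.
have y2 := loop_solution_L2e _ _ _ _ _ loop_wp u2 xs.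
have := loop_energy_le _ _ _ _ _ _ _ _ _ _ b d0 form u2 xs y2 T0.
set i := last_index n_gt0 in yx *.
have -> : norm_upto T y = norm_upto T (output (x i)).
  by rewrite /norm_upto (eq_truncate _ _ _ _ yx).
rewrite (bigD1 i)//=.
set A := \sum_(j < _ | _) _ => EA.
have A0 : 0 <= A by apply: sumr_ge0 => j _; rewrite mulr_ge0 ?sqr_ge0 ?ltW.
rewrite -ler_sqr ?nnegrE ?mulr_ge0 ?norm_upto_ge0 ?sqrtr_ge0//.
rewrite exprMn sqr_sqrtr; last by rewrite divr_ge0// ltW.
rewrite mulrAC ler_pdivlMr//.
have : 0 <= (1 - eta) * A by rewrite mulr_ge0// subr_ge0 ltW.
lra.
Qed.
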